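(* Work in the asymptotic setup of the context and let $\lambda^*>0$ be a minimizer over $\lambda$ of the asymptotic mean squared error $\mathbb E[(\eta_{\alpha\tau}(\Pi+\tau Z)-\Pi)^2]$, where $\alpha=\alpha(\lambda),\tau=\tau(\lambda)$. Suppose the interval condition (stated in the context) holds, and let $t_0^*$ be the value of the constant $t_0$ in it when $\lambda=\lambda^*$. Fix $t^*\in(0,t_0^*]$, consider the oracle procedure $\hat{\mathcal S}^*(t^* )$ with $\lambda=\lambda^*$, and let $\xi=\mathrm{tpp}^*(t^*;\lambda^* )$ be its asymptotic TPP. Let $\lambda\ne\lambda^*$ and a fixed $t$ be such that the oracle procedure $\hat{\mathcal S}^*(t)$ computed with this $\lambda$ satisfies $\mathrm{tpp}^*(t;\lambda)=\xi$. Then $$\mathrm{fdp}^*(t^*;\lambda^* )\le\mathrm{fdp}^*(t;\lambda).$$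
   Context: Setup. For each $p$, $n=n(p)$ with $n/p\to\delta\in(0,\infty)$ as $p\to\infty$. $Y=\boldsymbol X\beta+\zeta$, $\zeta\sim\mathcal N_n(0,\sigma^2\boldsymbol I)$, $\sigma>0$; $\boldsymbol X\in\mathbb R^{n\times p}$ has i.i.d. $\mathcal N(0,1/n)$ entries; $\beta_1,\dots,\beta_p$ are i.i.d. with law $\Pi=(1-\epsilon)\delta_0+\epsilon\Pi_1$, $\epsilon\in(0,1)$, $\mathbb P(\Pi_1=0)=0$, $\mathbb E\Pi^2<\infty$; $\boldsymbol X,\beta,\zeta$ are independent. ($\Pi,\Pi_1$ also denote random variables with these laws.) For $\lambda>0$, $\hat\beta=\hat\beta(\lambda)=\operatorname{argmin}_{b\in\mathbb R^p}\frac12\|Y-\boldsymbol Xb\|_2^2+\lambda\|b\|_1$. $\eta_s(x)=\operatorname{sign}(x)(|x|-s)_+$; $\Phi,\phi$ are the standard normal c.d.f. and density; $Z\sim\mathcal N(0,1)$ is independent of $\Pi,\Pi_1$. For each $\lambda>0$, $(\alpha,\tau)=(\alpha(\lambda),\tau(\lambda))$ is the unique solution with $\tau>0$, $\alpha>\alpha_{\min}$ of $$\tau^2=\sigma^2+\tfrac1\delta\mathbb E[(\eta_{\alpha\tau}(\Pi+\tau Z)-\Pi)^2],\qquad \lambda=\alpha\tau\big(1-\tfrac1\delta\mathbb P(|\Pi+\tau Z|>\alpha\tau)\big),$$ where $\alpha_{\min}$ is the unique non-negative root of $(\alpha^2+1)\Phi(-\alpha)-\alpha\phi(\alpha)=\delta/2$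 (and $\alpha_{\min}=0$ if $\delta\ge1$). Densities (all depending on $\lambda$ through $\alpha,\tau$). For $x\ne0$: $q_0(x)=\frac1\tau\phi\big(\frac{x+\alpha\tau\operatorname{sign}(x)}{\tau}\big)$, $q_1(x)=\mathbb E\big[\frac1\tau\phi\big(\frac{x+\alpha\tau\operatorname{sign}(x)-\Pi_1}{\tau}\big)\big]$, $q=(1-\epsilon)q_0+\epsilon q_1$; these are the densities of the absolutely continuous parts of the laws of $\eta_{\alpha\tau}(\tau Z)$, $\eta_{\alpha\tau}(\Pi_1+\tau Z)$, $\eta_{\alpha\tau}(\Pi+\tau Z)$. $f_0$ and $f$ are the generalized densities (with an atom at $0$) of $\eta_{\alpha\tau}(\tau Z)$ and $\eta_{\alpha\tau}(\Pi+\tau Z)$: $f_0(x)/f(x)=q_0(x)/q(x)$ for $x\neq0$ and $f_0(0)/f(0)=\mathbb P(|\tau Z|\le\alpha\tau)/\mathbb P(|\Pi+\tau Z|\le\alpha\tau)$. The local false discovery rate is $\mathrm{lfdr}(x)=(1-\epsilon)f_0(x)/f(x)$, so thresholding $f_0/f$ is the same as thresholding lfdr up to rescaling the threshold. Convention: the event $q_0(x)/q(x)\le t$ is regarded as not occurring when $x=0$. Interval condition (for each value of $\lambda$ under consideration, with constants depending on $\lambda$): there exist $t_0>0$ and $\Delta>0$ such that for every $0<t\le t_0$ the set $\{x\in\mathbb R: f_0(x)/f(x)\le t\}$ is a finite union of disjoint intervals with endpoints $a_m(t)<b_m(t)$, $m=1,\dots,M$ (infinite endpoints allowed), where for each $m$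 either $a_m(t)>\Delta$ or $b_m(t)<-\Delta$. Oracle. $\hat{\mathcal S}^*(t)=\{i\le p:\hat\beta_i(\lambda)\ne0,\ q_0(\hat\beta_i)/q(\hat\beta_i)\le t\}$. Its FDP is $|\hat{\mathcal S}^*(t)\cap\{i:\beta_i=0\}|/|\hat{\mathcal S}^*(t)|$ and its TPP is $|\hat{\mathcal S}^*(t)\cap\{i:\beta_i\ne0\}|/|\{i:\beta_i\neq0\}|$ (with $0/0:=0$). $\mathrm{fdp}^*(t;\lambda)$ and $\mathrm{tpp}^*(t;\lambda)$ denote their limits in probability as $p\to\infty$, which are given by $$\mathrm{tpp}^*(t;\lambda)=\mathbb P\Big(\tfrac{q_0(\eta_{\alpha\tau}(\Pi_1+\tau Z))}{q(\eta_{\alpha\tau}(\Pi_1+\tau Z))}\le t\Big),\qquad \mathrm{fdp}^*(t;\lambda)=\frac{(1-\epsilon)\,\mathbb P\big(\tfrac{q_0(\eta_{\alpha\tau}(\tau Z))}{q(\eta_{\alpha\tau}(\tau Z))}\le t\big)}{(1-\epsilon)\,\mathbb P\big(\tfrac{q_0(\eta_{\alpha\tau}(\tau Z))}{q(\eta_{\alpha\tau}(\tau Z))}\le t\big)+\epsilon\,\mathrm{tpp}^*(t;\lambda)}.$$ *)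

(* Defs.v *)
From HB Require Import structures.
From mathcomp Require Import all_boot all_order all_algebra.
From mathcomp Require Import all_classical all_reals all_analysis.

Set Implicit Arguments.
Unset Strict Implicit.
Unset Printing Implicit Defensive.

Import Order.TTheory GRing.Theory Num.Theory.
Import numFieldNormedType.Exports.

Local Open Scope classical_set_scope.
Local Open Scope ring_scope.

(* Conventions: [a] stands for alpha, [s] for tau; [Pi] and [Pi1] are laws on R,
   and independence of Pi (or Pi1) and Z is encoded by integrating against the
   product of the law with N(0,1).  Since
   [x / 0 = 0], proportions follow the convention 0/0 := 0. *)

Definition soft {R : realType} (th x : R) : R :=
  Num.sg x * Num.max (`|x| - th) 0.

Definition stdPhi {R : realType} (x : R) : R :=
  fine (normal_prob 0 1 [set y : R | y <= x]).

Definition stdphi {R : realType} (x : R) : R := normal_pdf 0 1 x.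

(* For delta < 1 the equation has exactly one non-negative root, so the default
   value of [xget] is not used. *)
Definition alpha_min {R : realType} (delta : R) : R :=
  if 1 <= delta then 0
  else xget 0 [set x : R | 0 <= x /\
    (x ^+ 2 + 1) * stdPhi (- x) - x * stdphi x = delta / 2].

(* E[(eta_{a s}(Pi + s Z) - Pi)^2], extended-real valued *)
Definition asymptotic_mse {R : realType} (Pi : probability R R) (a s : R)
    : \bar R :=
  (\int[Pi \x normal_prob (0 : R) 1]_u
     ((soft (a * s) (u.1 + s * u.2) - u.1) ^+ 2)%:E)%E.

Definition prob_signal_noise {R : realType} (L : probability R R) (s : R)
    (A : set R) : R :=
  fine ((L \x normal_prob (0 : R) 1)%E [set u | A (u.1 + s * u.2)]).

Definition prob_noise {R : realType} (s : R) (A : set R) : R :=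
  fine (normal_prob 0 1 [set z : R | A (s * z)]).

Definition state_evolution {R : realType} (delta sigma : R)
    (Pi : probability R R) (lambda a s : R) : Prop :=
  [/\ alpha_min delta < a, 0 < s,
      (s ^+ 2)%:E =
        ((sigma ^+ 2)%:E + delta^-1%:E * asymptotic_mse Pi a s)%E
    & lambda = a * s *
        (1 - delta^-1 * prob_signal_noise Pi s [set y | a * s < `|y|])].

Definition is_mixture {R : realType} (epsilon : R) (Pi1 Pi : probability R R) :
    Prop :=
  forall A : set R, measurable A ->
    Pi A = ((1 - epsilon)%:E * \d_(0%R : R) A + epsilon%:E * Pi1 A)%E.

Definition q0 {R : realType} (a s x : R) : R :=
  s^-1 * stdphi ((x + a * s * Num.sg x) / s).

Definition q1 {R : realType} (Pi1 : probability R R) (a s x : R) : R :=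
  \int[Pi1]_y (s^-1 * stdphi ((x + a * s * Num.sg x - y) / s)).

Definition q {R : realType} (epsilon : R) (Pi1 : probability R R) (a s x : R)
    : R :=
  (1 - epsilon) * q0 a s x + epsilon * q1 Pi1 a s x.

(* Generalized densities: the value at 0 is the mass of the atom. *)
Definition f0 {R : realType} (a s x : R) : R :=
  if x == 0 then prob_noise s [set y | `|y| <= a * s] else q0 a s x.

Definition f {R : realType} (epsilon : R) (Pi1 Pi : probability R R) (a s x : R)
    : R :=
  if x == 0 then prob_signal_noise Pi s [set y | `|y| <= a * s]
  else q epsilon Pi1 a s x.

(* [I] is an open, closed or half-open interval with endpoints [lo] and [hi]. *)
Definition has_endpoints {R : realType} (I : set R) (lo hi : \bar R) : Prop :=
  [set x : R | (lo < x%:E)%E /\ (x%:E < hi)%E] `<=` I /\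
  I `<=` [set x : R | (lo <= x%:E)%E /\ (x%:E <= hi)%E].

Definition interval_condition {R : realType} (epsilon : R)
    (Pi1 Pi : probability R R) (a s t0 : R) : Prop :=
  0 < t0 /\
  exists2 Delta : R, 0 < Delta &
  forall t : R, 0 < t -> t <= t0 ->
  exists (M : nat) (I : 'I_M -> set R) (lo hi : 'I_M -> \bar R),
  [/\ [set x : R | f0 a s x / f epsilon Pi1 Pi a s x <= t] =
        \bigcup_(m in [set: 'I_M]) I m,
      trivIset [set: 'I_M] I,
      forall m, has_endpoints (I m) (lo m) (hi m),
      forall m, (lo m < hi m)%E
    & forall m, (Delta%:E < lo m)%E \/ (hi m < (- Delta)%:E)%E].

Definition oracle_selects {R : realType} (epsilon : R) (Pi1 : probability R R)
    (a s t x : R) : bool :=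
  (x != 0) && (q0 a s x / q epsilon Pi1 a s x <= t).

Definition tpp_formula {R : realType} (epsilon : R) (Pi1 : probability R R)
    (a s t : R) : R :=
  prob_signal_noise Pi1 s
    [set y | oracle_selects epsilon Pi1 a s t (soft (a * s) y)].

Definition null_selection_prob {R : realType} (epsilon : R)
    (Pi1 : probability R R) (a s t : R) : R :=
  prob_noise s [set y | oracle_selects epsilon Pi1 a s t (soft (a * s) y)].

Definition fdp_formula {R : realType} (epsilon : R) (Pi1 : probability R R)
    (a s t : R) : R :=
  let null := (1 - epsilon) * null_selection_prob epsilon Pi1 a s t in
  null / (null + epsilon * tpp_formula epsilon Pi1 a s t).

(* For finitely many variables, the product rule over all choices of Borel sets
   gives the rule for subfamilies by taking [B k = setT] outside of them. *)
Definition mutually_independent {R : realType} (d : measure_display)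
    (T : measurableType d) (P : probability T R) (K : finType)
    (V : K -> T -> R) : Prop :=
  forall B : K -> set R, (forall k, measurable (B k)) ->
    P [set w | forall k, B k (V k w)] =
    (\prod_(k : K) fine (P [set w | B k (V k w)]))%:E.

Definition model_entries {R : realType} (n p : nat) (T : Type)
    (X : 'I_n -> 'I_p -> T -> R) (beta : 'I_p -> T -> R) (zeta : 'I_n -> T -> R)
    (k : ('I_n * 'I_p + 'I_p + 'I_n)%type) : T -> R :=
  match k with
  | inl (inl ij) => X ij.1 ij.2
  | inl (inr j) => beta j
  | inr i => zeta i
  end.

(* The standard deviation is the second parameter of [normal_prob]. *)
Record linear_model (R : realType) (delta sigma : R) (Pi : probability R R) :=
  LinearModel {
    nobs : nat -> nat ;
    nobs_cvg : (nobs p)%:R / p%:R @[p --> \oo] --> delta ;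
    disp : nat -> measure_display ;
    sample_space : forall p, measurableType (disp p) ;
    sample_prob : forall p, probability (sample_space p) R ;
    design : forall p, 'I_(nobs p) -> 'I_p -> {RV (sample_prob p) >-> R} ;
    signal : forall p, 'I_p -> {RV (sample_prob p) >-> R} ;
    noise : forall p, 'I_(nobs p) -> {RV (sample_prob p) >-> R} ;
    design_law : forall p i j (A : set R), measurable A ->
      distribution (sample_prob p) (@design p i j) A =
      normal_prob 0 (Num.sqrt (nobs p)%:R^-1) A ;
    signal_law : forall p j (A : set R), measurable A ->
      distribution (sample_prob p) (@signal p j) A = Pi A ;
    noise_law : forall p i (A : set R), measurable A ->
      distribution (sample_prob p) (@noise p i) A = normal_prob 0 sigma A ;
    model_independent : forall p,
      mutually_independent (sample_prob p)
        (model_entries (fun i j => @design p i j : _ -> R)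
           (fun j => @signal p j : _ -> R) (fun i => @noise p i : _ -> R))
  }.

Arguments design {R delta sigma Pi} _ {p} _ _.
Arguments signal {R delta sigma Pi} _ {p} _.
Arguments noise {R delta sigma Pi} _ {p} _.

Section Lasso.
Context {R : realType} {delta sigma : R} {Pi : probability R R}.
Implicit Type M : linear_model delta sigma Pi.

Definition design_mx M p (w : sample_space M p) : 'M[R]_(nobs M p, p) :=
  \matrix_(i, j) design M i j w.

Definition signal_vec M p (w : sample_space M p) : 'cV[R]_p :=
  \col_j signal M j w.

Definition noise_vec M p (w : sample_space M p) : 'cV[R]_(nobs M p) :=
  \col_i noise M i w.

Definition response M p (w : sample_space M p) : 'cV[R]_(nobs M p) :=
  design_mx w *m signal_vec w + noise_vec w.

Definition lasso_objective M p (w : sample_space M p) (lambda : R)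
    (b : 'cV[R]_p) : R :=
  2^-1 * \sum_i ((response w - design_mx w *m b) i 0) ^+ 2 +
  lambda * \sum_j `|b j 0|.

Definition is_lasso M (bhat : R -> forall p, sample_space M p -> 'cV[R]_p) :
    Prop :=
  forall (lambda : R), 0 < lambda ->
  forall p (w : sample_space M p) (b : 'cV[R]_p),
    lasso_objective w lambda (bhat lambda p w) <= lasso_objective w lambda b.

Definition oracle_set (epsilon : R) (Pi1 : probability R R) (a s t : R)
    (p : nat) (b : 'cV[R]_p) : {set 'I_p} :=
  [set i | oracle_selects epsilon Pi1 a s t (b i 0)]%SET.

Definition fdp_of (p : nat) (S : {set 'I_p}) (beta : 'cV[R]_p) : R :=
  #|S :&: [set i | beta i 0%R == 0%R]%SET|%:R / #|S|%:R.

Definition tpp_of (p : nat) (S : {set 'I_p}) (beta : 'cV[R]_p) : R :=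
  #|S :&: [set i | beta i 0%R != 0%R]%SET|%:R /
  #|[set i | beta i 0%R != 0%R]%SET|%:R.

(* Convergence in probability to a constant.  The outer measure [mu_ext] agrees
   with the probability on events; it dispenses with requiring that the
   selection of a minimizer (unique only almost surely) be measurable. *)
Definition cvg_in_prob M (V : forall p, sample_space M p -> R) (v : R) : Prop :=
  forall e : R, 0 < e ->
    mu_ext (sample_prob M p) [set w | e <= `|V p w - v|] @[p --> \oo] --> 0%E.

(* [tpp] and [fdp] are the limits in probability of the TPP and the FDP of the
   oracle procedure with threshold [t], computed with the Lasso at [lambda]. *)
Definition oracle_limits M (bhat : R -> forall p, sample_space M p -> 'cV[R]_p)
    (epsilon : R) (Pi1 : probability R R) (alpha tau : R -> R) (t lambda : R)
    (tpp fdp : R) : Prop :=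
  let S p (w : sample_space M p) :=
    oracle_set epsilon Pi1 (alpha lambda) (tau lambda) t (bhat lambda p w) in
  cvg_in_prob
    (fun p (w : sample_space M p) => tpp_of (S p w) (signal_vec w)) tpp /\
  cvg_in_prob
    (fun p (w : sample_space M p) => fdp_of (S p w) (signal_vec w)) fdp.

End Lasso.

(* Main.v *)
Require Import Defs.
From mathcomp Require Import all_boot all_order all_algebra.
From mathcomp Require Import all_classical all_reals all_analysis.
From mathcomp Require Import measurable_realfun ring lra.

Import Order.TTheory GRing.Theory Num.Theory.
Import numFieldNormedType.Exports.

Local Open Scope classical_set_scope.
Local Open Scope ring_scope.

(* Since [s ^+ 2 = sigma ^+ 2 + mse / delta], minimality of the mean squared
   error says that the noise level at [lambda_star] is the smallest.  On
   [`|y| > a * s] the oracle at [lambda] is a test on [y = Pi + s * Z] between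
   [Pi = 0] and [Pi ~ Pi1].  Adding independent Gaussian noise to the
   observation at [lambda_star] turns that test into a randomized test at the
   smaller noise level with the same errors, so it suffices that the oracle at
   [lambda_star] is a Neyman-Pearson test.  The only obstacle is that it never
   selects [`|y| <= a * s].  The likelihood ratio
   [E[exp (y * Pi1 / s ^+ 2 - Pi1 ^+ 2 / (2 * s ^+ 2))]] is convex in [y],
   and by the interval condition it is below the threshold slightly outside both
   endpoints of [`|y| <= a * s]; hence it is below the threshold inside. *)

(** * Gaussian laws: change of variables and convolution *)

Lemma normal_pdf_scale (R : realType) (u s y : R) : 0 < s ->
  s^-1 * normal_pdf 0 1 ((y - u) / s) = normal_pdf u s y.
Proof.
move=> s0; rewrite !normal_pdfE ?oner_eq0 ?gt_eqF// mulrA; congr (_ * _).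
  rewrite /normal_peak -invfM; congr (_^-1).
  rewrite -[in RHS]mulrnAr sqrtrM ?sqr_ge0// sqrtr_sqr gtr0_norm//.
  by rewrite expr1n mul1r.
rewrite /normal_fun; congr expR.
rewrite subr0 -mulr_natr -[in RHS]mulr_natr; field.
by rewrite gt_eqF.
Qed.

Lemma normal_prob_affine (R : realType) (u s : R) (A : set R) : 0 < s ->
  measurable A ->
  normal_prob 0 1 [set z | A (u + s * z)] = normal_prob u s A.
Proof.
move=> s0 mA.
pose phi : R -> measurableTypeR R := fun z => u + s * z.
have mphi : measurable_fun setT phi.
  by apply: measurable_funD => //; apply: measurable_funM.
pose k : {nonneg R} := NngNum (ltW s0).
(* Scaling of Lebesgue measure under [phi]; by uniqueness it suffices to compare the two measures on
   half-open intervals. *)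
have lebE : forall B : set R, measurable B ->
    (lebesgue_measure B = s%:E * lebesgue_measure (phi @^-1` B))%E.
  apply: (lebesgue_measure_unique
    (mu := mscale k (pushforward lebesgue_measure phi))).
  move=> X [[a b] _ <-].
  pose J := `](a - u) / s, (b - u) / s]%classic.
  have phiE : phi @^-1` `]a, b]%classic = J.
    apply/seteqP; split => z /=;
      rewrite /J /= !in_itv /phi/= ltr_pdivrMr// ler_pdivlMr//.
      by move=> /andP[h1 h2]; apply/andP; split; lra.
    by move=> /andP[h1 h2]; apply/andP; split; lra.
  transitivity (s%:E * lebesgue_measure J)%E;
    last by rewrite -phiE.
  rewrite /J !lebesgue_measure_itv/= !lte_fin ltr_pM2r ?invr_gt0//= ltrD2r.
  case: ifP => _; last by rewrite mule0.
  by rewrite -!EFinD -EFinM; congr (_%:E); field; rewrite gt_eqF.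
have mpdf : measurable_fun A (fun y : R => (normal_pdf u s y)%:E).
  by apply/measurable_EFinP/measurable_funTS; exact: measurable_normal_pdf.
rewrite /normal_prob.
rewrite [RHS](eq_measure_integral
  (mscale k (pushforward lebesgue_measure phi)));
  last by move=> B mB _; exact: lebE.
rewrite ge0_integral_mscale//; last first.
  by move=> y _; rewrite lee_fin normal_pdf_ge0.
rewrite ge0_integral_pushforward//; last first.
  by move=> y _; rewrite lee_fin normal_pdf_ge0.
rewrite -ge0_integralZl//=.
- apply: eq_integral => z _.
  rewrite -EFinM -[normal_pdf u s _]normal_pdf_scale// mulrA divff ?gt_eqF//.
  by rewrite mul1r /phi (addrC u) addrK mulrAC divff ?gt_eqF// mul1r.
- by rewrite -[_ @^-1` _]setTI; exact: mphi.
- apply: (measurableT_comp (f := EFin)) => //.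
  apply/measurable_funTS/measurableT_comp => //; exact: measurable_normal_pdf.
- by move=> z _; rewrite lee_fin normal_pdf_ge0.
- by rewrite lee_fin ltW.
Qed.

Lemma normal_prob_indic (R : realType) (u s : R) (A : set R) :
  normal_prob u s A =
    (\int[lebesgue_measure]_y ((\1_A y)%:E * (normal_pdf u s y)%:E))%E.
Proof.
rewrite /normal_prob [LHS]integral_mkcond epatch_indic.
by apply: eq_integral => y _; rewrite /= muleC.
Qed.

Lemma measurable_normal_pdf2 (R : realType) (s : R) : 0 < s ->
  measurable_fun setT (fun u : R * R => normal_pdf u.1 s u.2).
Proof.
move=> s0.
rewrite (_ : (fun _ => _) = fun u : R * R => normal_pdf 0 s (u.2 - u.1)).
  apply: measurableT_comp; first exact: measurable_normal_pdf.
  exact: measurable_funB.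
by apply/funext => u; rewrite !normal_pdfE ?gt_eqF// /normal_fun subr0.
Qed.

(** Bayes factorization, by completing the square in [y]: a prior [N(u, s0 ^+ 2)] on [y] and an
    observation [x] of [y] with noise variance [r ^+ 2] give the marginal density of [x] times the
    posterior density of [y]. *)
Lemma normal_pdfM (R : realType) (s0 r s u x y : R) :
  0 < s0 -> 0 < r -> 0 < s -> s ^+ 2 = s0 ^+ 2 + r ^+ 2 ->
  normal_pdf u s0 y * normal_pdf y r x =
  normal_pdf u s x *
    normal_pdf ((u * r ^+ 2 + x * s0 ^+ 2) / s ^+ 2) (s0 * r / s) y.
Proof.
move=> s0_gt0 r_gt0 s_gt0 sE.
have v_gt0 : 0 < s0 * r / s by rewrite divr_gt0// mulr_gt0.
rewrite !normal_pdfE ?gt_eqF// mulrACA [RHS]mulrACA; congr (_ * _).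
  rewrite /normal_peak -!invfM -!sqrtrM; last 2 first.
  - by rewrite mulrn_wge0// mulr_ge0 ?sqr_ge0 ?pi_ge0.
  - by rewrite mulrn_wge0// mulr_ge0 ?sqr_ge0 ?pi_ge0.
  congr (Num.sqrt _)^-1.
  by rewrite -!(mulr_natr (_ * pi)); field; rewrite gt_eqF.
rewrite /normal_fun -!expRD; congr expR.
rewrite -!(mulr_natr (_ ^+ 2)) exprMn exprVn exprMn.
have : s ^+ 2 != 0 by rewrite sqrf_eq0 gt_eqF.
rewrite sE => s2_neq0.
field.
by rewrite s2_neq0 !gt_eqF.
Qed.

(** In the factorization [normal_pdfM] the posterior density of [y] integrates to 1 and leaves the
    marginal of [x]; Tonelli exchanges the two integrations. *)
Lemma normal_prob_convolution (R : realType) (s0 r s u : R) (A : set R) :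
  0 < s0 -> 0 < r -> 0 < s -> s ^+ 2 = s0 ^+ 2 + r ^+ 2 -> measurable A ->
  (normal_prob u s A =
   \int[lebesgue_measure]_y (normal_prob y r A * (normal_pdf u s0 y)%:E))%E.
Proof.
move=> s0_gt0 r_gt0 s_gt0 sE mA.
pose F (z : R * R) :=
  ((\1_A z.1)%:E * (normal_pdf u s0 z.2 * normal_pdf z.2 r z.1)%:E)%E.
have mF : measurable_fun setT F.
  apply: emeasurable_funM.
    by apply/measurable_EFinP; apply: measurableT_comp.
  apply/measurable_EFinP; apply: measurable_funM.
    by apply: measurableT_comp; first exact: measurable_normal_pdf.
  apply: (measurableT_comp (f := fun v : R * R => normal_pdf v.1 r v.2)
    (g := fun z : R * R => (z.2, z.1))); first exact: measurable_normal_pdf2.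
  exact: measurable_fun_pair.
have F_ge0 z : (0 <= F z)%E.
  by rewrite mule_ge0// lee_fin ?mulr_ge0 ?normal_pdf_ge0.
transitivity (\int[lebesgue_measure]_x \int[lebesgue_measure]_y F (x, y))%E.
  rewrite /normal_prob integral_mkcond; apply: eq_integral => x _.
  rewrite /F/= epatch_indic/= [RHS]ge0_integralZl//.
  - rewrite muleC; congr (_ * _)%E.
    under eq_integral do
      rewrite (normal_pdfM _ _ _ _ _ _ _ s0_gt0 r_gt0 s_gt0 sE) EFinM.
    rewrite ge0_integralZl//.
    + by rewrite integral_normal_pdf mule1.
    + by apply/measurable_EFinP; exact: measurable_normal_pdf.
    + by move=> y _; rewrite lee_fin normal_pdf_ge0.
    + by rewrite lee_fin normal_pdf_ge0.
  - under eq_fun do rewrite (normal_pdfM _ _ _ _ _ _ _ s0_gt0 r_gt0 s_gt0 sE).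
    apply/measurable_EFinP; apply: measurable_funM => //.
    exact: measurable_normal_pdf.
  - by move=> y _; rewrite lee_fin mulr_ge0 ?normal_pdf_ge0.
rewrite fubini_tonelli//; apply: eq_integral => y _.
rewrite /normal_prob [in RHS]integral_mkcond epatch_indic muleC.
rewrite -ge0_integralZl//.
- apply: eq_integral => x _; rewrite /F/= EFinM muleCA; congr (_ * _)%E.
  by rewrite muleC.
- apply: emeasurable_funM; apply/measurable_EFinP.
    exact: measurable_normal_pdf.
  exact: measurable_indic.
- by move=> x _ /=; rewrite mule_ge0 ?lee_fin ?normal_pdf_ge0.
- by rewrite lee_fin normal_pdf_ge0.
Qed.

Lemma measurable_normal_prob_mean (R : realType) (s : R) (A : set R) : 0 < s ->
  measurable A -> measurable_fun setT (fun u : R => normal_prob u s A).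
Proof.
move=> s_gt0 mA.
pose F (z : R * R) := ((normal_pdf z.1 s z.2)%:E * (\1_A z.2)%:E)%E.
rewrite (_ : (fun _ => _) = fubini_F lebesgue_measure F); last first.
  apply/funext => u; rewrite /fubini_F /normal_prob [LHS]integral_mkcond.
  by rewrite epatch_indic.
apply: measurable_fun_fubini_tonelli_F.
- apply: emeasurable_funM; apply/measurable_EFinP.
    exact: measurable_normal_pdf2.
  by apply: measurableT_comp => //; exact: measurable_indic.
- by move=> z; rewrite mule_ge0// lee_fin ?normal_pdf_ge0.
Qed.

(* Adding independent noise of variance [s ^+ 2 - s0 ^+ 2] turns a test at noise
   level [s] into a randomized test [psi] at noise level [s0]. *)
Lemma normal_prob_randomized (R : realType) (s0 s : R) (A : set R) :
  0 < s0 -> s0 <= s -> measurable A ->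
  exists psi : R -> \bar R, [/\ measurable_fun setT psi,
    forall y, (0 <= psi y <= 1)%E &
    forall u, (normal_prob u s A =
      \int[lebesgue_measure]_y (psi y * (normal_pdf u s0 y)%:E))%E].
Proof.
(* When the levels coincide the added noise would be degenerate, so the test is kept as its own
   indicator. *)
move=> s0_gt0 s0_le mA; have [s0E|s0_neq] := eqVneq s0 s.
  exists (fun y => (\1_A y)%:E); split.
  - by apply/measurable_EFinP; exact: measurable_indic.
  - move=> y; rewrite indicE.
    by case: (_ \in _); rewrite !lee_fin/= ?ler01 ?lexx.
  - by move=> u; rewrite s0E; exact: normal_prob_indic.
have s_gt0 : 0 < s by exact: lt_le_trans s0_le.
have lt_s : s0 < s by rewrite lt_neqAle s0_neq.
have d_gt0 : 0 < s ^+ 2 - s0 ^+ 2 by rewrite subr_gt0 ltr_pXn2r// nnegrE ltW.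
pose r := Num.sqrt (s ^+ 2 - s0 ^+ 2).
have r_gt0 : 0 < r by rewrite sqrtr_gt0.
exists (fun y => normal_prob y r A); split.
- exact: measurable_normal_prob_mean.
- by move=> y; rewrite measure_ge0 probability_le1.
- move=> u; apply: normal_prob_convolution => //.
  by rewrite sqr_sqrtr ?ltW// addrC subrK.
Qed.

(** Since one [psi] serves all means [u], it also serves any mixture of them: integrate over [u]
    under [L] and exchange the integrals. *)
Lemma signal_noise_integral (R : realType) (L : probability R R) (s0 s : R)
    (A : set R) (psi : R -> \bar R) :
  0 < s0 -> 0 < s -> measurable A -> measurable_fun setT psi ->
  (forall y, (0 <= psi y)%E) ->
  (forall u, (normal_prob u s A =
      \int[lebesgue_measure]_y (psi y * (normal_pdf u s0 y)%:E))%E) ->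
  ((L \x normal_prob (0 : R) 1) [set w | A (w.1 + s * w.2)%R] =
   \int[lebesgue_measure]_y (psi y * \int[L]_u (normal_pdf u s0 y)%:E))%E.
Proof.
move=> s0_gt0 s_gt0 mA mpsi psi_ge0 psiE.
pose F (z : R * R) := (psi z.2 * (normal_pdf z.1 s0 z.2)%:E)%E.
have mF : measurable_fun setT F.
  apply: emeasurable_funM; first exact: measurableT_comp.
  by apply/measurable_EFinP; exact: measurable_normal_pdf2.
have F_ge0 z : (0 <= F z)%E by rewrite mule_ge0// lee_fin normal_pdf_ge0.
transitivity (\int[L]_u \int[lebesgue_measure]_y F (u, y))%E.
  rewrite /product_measure1/=; apply: eq_integral => u _.
  rewrite -psiE -(normal_prob_affine _ _ _ _ s_gt0)//=; congr normal_prob.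
  by apply/seteqP; split => z; rewrite /xsection/= inE.
rewrite fubini_tonelli//; apply: eq_integral => y _.
rewrite -ge0_integralZl//.
- apply/measurable_EFinP.
  apply: (measurableT_comp (f := fun v : R * R => normal_pdf v.1 s0 v.2)
    (g := fun z : R => (z, y))); first exact: measurable_normal_pdf2.
  exact: measurable_fun_pair.
- by move=> u _; rewrite lee_fin normal_pdf_ge0.
Qed.

(** * Convexity of the likelihood ratio of a Gaussian mixture *)

Section mixture.
Context {R : realType} (L : probability R R) (s : R) (s_gt0 : 0 < s).

(** The density of [U + s * Z] for [U] of law [L] and an independent standard normal [Z]. *)
Definition mixture_pdf (y : R) : R := \int[L]_u normal_pdf u s y.

Lemma integrable_normal_pdf_mean (y : R) :
  L.-integrable setT (EFin \o fun u => normal_pdf u s y).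
Proof.
apply: (le_integrable _ _ _
  (finite_measure_integrable_cst L (normal_peak s) measurableT)) => //.
- apply/measurable_EFinP.
  apply: (measurableT_comp (f := fun v : R * R => normal_pdf v.1 s v.2)
    (g := fun z : R => (z, y))); first exact: measurable_normal_pdf2.
  exact: measurable_fun_pair.
- move=> u _; rewrite /= lee_fin !ger0_norm ?normal_pdf_ge0 ?normal_peak_ge0//.
  by rewrite normal_pdf_ub// gt_eqF.
Qed.

Lemma EFin_mixture_pdf (y : R) :
  (\int[L]_u (normal_pdf u s y)%:E)%E = (mixture_pdf y)%:E.
Proof.
by rewrite /mixture_pdf /Rintegral fineK//; apply: integrable_fin_num => //;
  exact: integrable_normal_pdf_mean.
Qed.

Lemma mixture_pdf_ge0 (y : R) : 0 <= mixture_pdf y.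
Proof. by apply: Rintegral_ge0 => u _; exact: normal_pdf_ge0. Qed.

Lemma measurable_mixture_pdf : measurable_fun setT mixture_pdf.
Proof.
apply/measurable_EFinP.
rewrite (_ : EFin \o _ = fubini_G L
    (fun z : R * R => (normal_pdf z.1 s z.2)%:E)); last first.
  by apply/funext => y; rewrite /= -EFin_mixture_pdf.
apply: measurable_fun_fubini_tonelli_G => //.
  by apply/measurable_EFinP; exact: measurable_normal_pdf2.
by move=> z; rewrite lee_fin normal_pdf_ge0.
Qed.

Lemma normal_pdf_gt0 (u y : R) : 0 < normal_pdf u s y.
Proof.
by rewrite normal_pdfE ?gt_eqF// mulr_gt0 ?expR_gt0// normal_peak_gt0 ?gt_eqF.
Qed.

(** The likelihood ratio of mean [u] against mean [0] is the exponential of an affine function of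
    [y], which is the source of its convexity. *)
Lemma normal_pdf_tilt (u y : R) : normal_pdf u s y =
  normal_pdf 0 s y * expR (u / s ^+ 2 * y - u ^+ 2 / (s ^+ 2 *+ 2)).
Proof.
rewrite !normal_pdfE ?gt_eqF//= -[RHS]mulrA; congr (_ * _).
rewrite /normal_fun -expRD; congr expR.
by rewrite -!(mulr_natr (s ^+ 2)); field; rewrite gt_eqF.
Qed.

(** Convexity of [expR] applied to the tilt. The denominator at the middle point is cleared so that
    the bound can be integrated over [u]. *)
Lemma normal_pdf_ratio_convex (w u y1 y2 : R) : 0 <= w <= 1 ->
  normal_pdf u s (w * y1 + (1 - w) * y2) <=
  normal_pdf 0 s (w * y1 + (1 - w) * y2) *
    (w * (normal_pdf u s y1 / normal_pdf 0 s y1) +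
     (1 - w) * (normal_pdf u s y2 / normal_pdf 0 s y2)).
Proof.
move=> /andP[w0 w1]; set y := w * y1 + _.
rewrite 3![normal_pdf u _ _]normal_pdf_tilt.
rewrite ![normal_pdf 0 s _ * expR _]mulrC !mulfK ?gt_eqF ?normal_pdf_gt0//.
rewrite [leRHS]mulrC ler_pM2r ?normal_pdf_gt0//.
have := convex_expR (Itv01 w0 w1) (u / s ^+ 2 * y1 - u ^+ 2 / (s ^+ 2 *+ 2))
  (u / s ^+ 2 * y2 - u ^+ 2 / (s ^+ 2 *+ 2)).
rewrite !convRE/=; apply: le_trans; rewrite ler_expR /y.
by rewrite le_eqVlt; apply/orP; left; apply/eqP; rewrite /unstable.onem; ring.
Qed.

(* The likelihood ratio [mixture_pdf y / normal_pdf 0 s y] is convex in [y]. *)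
Lemma mixture_pdf_lt_itv (c k y1 y y2 : R) : 0 <= c -> y1 <= y <= y2 ->
  c * mixture_pdf y1 < k * normal_pdf 0 s y1 ->
  c * mixture_pdf y2 < k * normal_pdf 0 s y2 ->
  c * mixture_pdf y < k * normal_pdf 0 s y.
Proof.
move=> c0 /andP[y1y yy2] h1 h2.
have [y12|y12] := eqVneq y1 y2.
  by rewrite (_ : y = y1)//; apply/le_anti; rewrite y1y y12 yy2.
have d_gt0 : 0 < y2 - y1.
  by rewrite subr_gt0 lt_neqAle y12 (le_trans y1y).
pose w := (y2 - y) / (y2 - y1).
have w01 : 0 <= w <= 1.
  rewrite /w ler_pdivrMr// mul1r lerD2l lerN2 y1y andbT.
  by rewrite divr_ge0 ?subr_ge0 ?(le_trans y1y).
have yE : y = w * y1 + (1 - w) * y2.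
  by rewrite /w; field; rewrite gt_eqF.
clearbody w.
(* These weights do not depend on [u], so the pointwise bound integrates to one on [mixture_pdf];
   the same weights recombine the null density at [y] exactly. *)
pose a1 := normal_pdf 0 s y * w / normal_pdf 0 s y1.
pose a2 := normal_pdf 0 s y * (1 - w) / normal_pdf 0 s y2.
have iZ a z : L.-integrable setT (EFin \o fun u => a * normal_pdf u s z).
  exact: (integrableZl measurableT a (integrable_normal_pdf_mean z)).
have : mixture_pdf y <= a1 * mixture_pdf y1 + a2 * mixture_pdf y2.
  rewrite /mixture_pdf -!RintegralZl//; do ?exact: integrable_normal_pdf_mean.
  rewrite -RintegralD//; apply: le_Rintegral => //.
  - exact: integrable_normal_pdf_mean.
  - exact: (integrableD measurableT (iZ a1 y1) (iZ a2 y2)).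
  - move=> u _; have := normal_pdf_ratio_convex w u y1 y2 w01.
    rewrite -yE => /le_trans; apply.
    by rewrite le_eqVlt /a1 /a2; apply/orP; left; apply/eqP; ring.
move=> /(ler_wpM2l c0)/le_lt_trans; apply.
rewrite mulrDr !(mulrCA c).
have -> : k * normal_pdf 0 s y =
    a1 * (k * normal_pdf 0 s y1) + a2 * (k * normal_pdf 0 s y2).
  by rewrite /a1 /a2; field; rewrite !gt_eqF ?normal_pdf_gt0.
case/andP: w01 => w0 w1.
have a1_ge0 : 0 <= a1.
  by rewrite divr_ge0 ?mulr_ge0 ?normal_pdf_ge0.
have a2_ge0 : 0 <= a2.
  by rewrite divr_ge0 ?mulr_ge0 ?normal_pdf_ge0 ?subr_ge0.
(* One weight may vanish, so strictness is taken from the second term if [w = 0] and from the first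
   otherwise. *)
have [w_eq0|w_neq0] := eqVneq w 0.
  apply: ler_ltD; first by rewrite ler_wpM2l// ltW.
  by rewrite ltr_pM2l// /a2 w_eq0 subr0 mulr1 divr_gt0 ?normal_pdf_gt0.
apply: ltr_leD; last by rewrite ler_wpM2l// ltW.
rewrite ltr_pM2l// /a1 divr_gt0 ?mulr_gt0 ?normal_pdf_gt0//.
by rewrite lt_neqAle eq_sym w_neq0.
Qed.

End mixture.

(** * Limits in probability and the Neyman-Pearson comparison *)

(** With [e] half the distance between the limits, the two deviation events cover the sample space
    by the triangle inequality. Subadditivity of the outer measure then keeps the sum of their
    measures at least 1, while it tends to 0. *)
Lemma cvg_in_prob_unique (R : realType) (delta sigma : R) (Pi : probability R R)
    (M : linear_model delta sigma Pi) (V : forall p, sample_space M p -> R)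
    (v v' : R) : cvg_in_prob V v -> cvg_in_prob V v' -> v = v'.
Proof.
move=> Vv Vv'; apply/eqP/negP => /negP vv'.
pose e := `|v - v'| / 2.
have e_gt0 : 0 < e by rewrite divr_gt0// normr_gt0 subr_eq0.
have h : (mu_ext (sample_prob M p) [set w | (e <= `|V p w - v|)%R] +
    mu_ext (sample_prob M p) [set w | (e <= `|V p w - v'|)%R])%E
    @[p --> \oo] --> (0 + 0)%E.
  by apply: cvgeD => //; [exact: Vv|exact: Vv'].
rewrite adde0 in h.
have : (1 <= 0 :> \bar R)%E.
  rewrite -(cvg_lim _ h)//; apply: lime_ge; first by apply/cvg_ex; exists 0%E.
  apply: nearW => p.
  rewrite -(@probability_setT _ _ _ (sample_prob M p)).
  rewrite -(@measurable_mu_extE _ _ _ (sample_prob M p))//.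
  apply: le_trans (outer_measureU2 _ _ _).
  apply: le_mu_ext => w _ /=.
  have [|lt1] := leP e `|V p w - v|; [by left|].
  have [|lt2] := leP e `|V p w - v'|; [by right|].
  exfalso; have := ler_distD (V p w) v v'.
  rewrite leNgt => /negP; apply.
  by rewrite (distrC v) [ltRHS]splitr ltrD.
by rewrite lee_fin ler10.
Qed.

(* Pointwise, [(chi - psi) * (c * p1 - k * p0) >= 0]; the terms are arranged so
   that only nonnegative functions are integrated. *)
Lemma neyman_pearson (R : realType) (p0 p1 : R -> R) (chi psi : R -> \bar R)
    (k c : R) :
  measurable_fun setT p0 -> measurable_fun setT p1 ->
  (forall y, 0 <= p0 y) -> (forall y, 0 <= p1 y) ->
  measurable_fun setT chi -> measurable_fun setT psi ->
  (forall y, (0 <= psi y <= 1)%E) ->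
  0 < k -> 0 <= c ->
  (forall y, chi y = if k * p0 y <= c * p1 y then 1%E else 0%E) ->
  (\int[lebesgue_measure]_y (psi y * (p1 y)%:E) \is a fin_num)%E ->
  (\int[lebesgue_measure]_y (chi y * (p1 y)%:E) =
   \int[lebesgue_measure]_y (psi y * (p1 y)%:E))%E ->
  (\int[lebesgue_measure]_y (chi y * (p0 y)%:E) <=
   \int[lebesgue_measure]_y (psi y * (p0 y)%:E))%E.
Proof.
move=> mp0 mp1 p0_ge0 p1_ge0 mchi mpsi psi01 k_gt0 c_ge0 chiE fin eq_power.
have chi_ge0 y : (0 <= chi y)%E by rewrite chiE; case: ifP.
have psi_ge0 y : (0 <= psi y)%E by case/andP: (psi01 y).
have mI (g : R -> \bar R) (p : R -> R) : measurable_fun setT g ->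
    measurable_fun setT p -> measurable_fun setT (fun y => g y * (p y)%:E)%E.
  by move=> mg mp; apply: emeasurable_funM => //; exact/measurable_EFinP.
have I_ge0 (g : R -> \bar R) (p : R -> R) y : (0 <= g y)%E -> 0 <= p y ->
    (0 <= g y * (p y)%:E)%E.
  by move=> g0 p_0; rewrite mule_ge0// lee_fin.
have split_int (g h : R -> \bar R) (p q : R -> R) (a b : R) :
    measurable_fun setT g -> measurable_fun setT h ->
    measurable_fun setT p -> measurable_fun setT q ->
    (forall y, 0 <= g y)%E -> (forall y, 0 <= h y)%E ->
    (forall y, 0 <= p y) -> (forall y, 0 <= q y) -> 0 <= a -> 0 <= b ->
    (\int[lebesgue_measure]_y
        (a%:E * (g y * (p y)%:E) + b%:E * (h y * (q y)%:E)) =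
     a%:E * \int[lebesgue_measure]_y (g y * (p y)%:E) +
     b%:E * \int[lebesgue_measure]_y (h y * (q y)%:E))%E.
  move=> mg mh mp mq g0 h0 p_0 q_0 a0 b0.
  rewrite ge0_integralD//.
  - rewrite !ge0_integralZl// ?lee_fin//; try exact: mI.
    + by move=> y _; exact: I_ge0.
    + by move=> y _; exact: I_ge0.
  - by move=> y _; rewrite mule_ge0 ?I_ge0 ?lee_fin.
  - by apply: emeasurable_funM => //; exact: mI.
  - by move=> y _; rewrite mule_ge0 ?I_ge0 ?lee_fin.
  - by apply: emeasurable_funM => //; exact: mI.
have k_ge0 := ltW k_gt0.
have : (\int[lebesgue_measure]_y
      (c%:E * (psi y * (p1 y)%:E) + k%:E * (chi y * (p0 y)%:E)) <=
    \int[lebesgue_measure]_y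
      (c%:E * (chi y * (p1 y)%:E) + k%:E * (psi y * (p0 y)%:E)))%E.
  apply: ge0_le_integral => //.
  - by move=> y _; apply: adde_ge0; apply: mule_ge0; rewrite ?lee_fin ?I_ge0.
  - by apply: emeasurable_funD; apply: emeasurable_funM => //; exact: mI.
  - by apply: emeasurable_funD; apply: emeasurable_funM => //; exact: mI.
  - move=> y _; rewrite chiE; move: (psi01 y).
    case: (psi y) => [r|/andP[_]|/andP[]]//=.
    rewrite !lee_fin => /andP[r0 r1].
    by case: (leP (k * p0 y)) => h;
      rewrite ?(mul1e, mul0e, mule0, adde0, add0e) -?EFinM -?EFinD lee_fin; nra.
(* Equal powers cancel, which in the extended reals relies on their finiteness; the factor [k] is
   then divided out. *)
rewrite !split_int// eq_power leeD2lE; last by rewrite fin_numM.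
by rewrite lee_pmul2l// ?lte_fin.
Qed.

(** * The oracle as a likelihood-ratio test on the observation *)

Lemma soft_le (R : realType) (th y : R) : `|y| <= th -> soft th y = 0.
Proof. by move=> yth; rewrite /soft max_r ?mulr0// subr_le0. Qed.

Lemma sg_soft (R : realType) (th y : R) : 0 <= th -> th < `|y| ->
  Num.sg (soft th y) = Num.sg y.
Proof.
move=> th0 thy; rewrite /soft max_l ?subr_ge0 1?ltW// sgrM sgr_id.
by rewrite [Num.sg (_ - _)]gtr0_sg ?subr_gt0// mulr1.
Qed.

(** The shift by [th * Num.sg] in [q0] and [q1] undoes soft thresholding, so these densities at the
    estimate are Gaussian and mixture densities at the observation [y]. *)
Lemma soft_gtK (R : realType) (th y : R) : 0 <= th -> th < `|y| ->
  soft th y + th * Num.sg (soft th y) = y.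
Proof.
move=> th0 thy; rewrite sg_soft// /soft max_l ?subr_ge0 1?ltW//.
by rewrite (mulrC th) -mulrDr subrK -numEsg.
Qed.

Lemma alpha_min_ge0 (R : realType) (delta : R) : 0 <= alpha_min delta.
Proof.
rewrite /alpha_min; case: ifP => // _.
(* The value is either a root, non-negative by the defining set, or the default [0]. *)
by case: xgetP => [x _ []|].
Qed.

Section selection.
Context {R : realType} (epsilon : R) (Pi1 : probability R R) (s : R).
Hypotheses (epsilon_gt0 : 0 < epsilon) (epsilon_lt1 : epsilon < 1).
Hypothesis s_gt0 : 0 < s.

Lemma q0_normal_pdf (a x : R) :
  q0 a s x = normal_pdf 0 s (x + a * s * Num.sg x).
Proof. by rewrite -normal_pdf_scale// subr0. Qed.

Lemma q1_mixture_pdf (a x : R) :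
  q1 Pi1 a s x = mixture_pdf Pi1 s (x + a * s * Num.sg x).
Proof. by apply: eq_Rintegral => u _; rewrite -normal_pdf_scale. Qed.

(** The denominator [q] is positive because [q0] is, so it can be cleared; collecting the null terms
    gives a likelihood-ratio threshold at [y]. *)
Lemma ratio_le (a t x : R) : let y := x + a * s * Num.sg x in
  (q0 a s x / q epsilon Pi1 a s x <= t) =
  ((1 - t * (1 - epsilon)) * normal_pdf 0 s y <=
   t * epsilon * mixture_pdf Pi1 s y).
Proof.
move=> y; rewrite /q q0_normal_pdf q1_mixture_pdf -/y.
have p0_gt0 := normal_pdf_gt0 s s_gt0 0 y.
have p1_ge0 := mixture_pdf_ge0 Pi1 s y.
rewrite ler_pdivrMr; last first.
  by rewrite ltr_pwDl ?mulr_ge0 ?mulr_gt0 ?subr_gt0// ltW.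
by rewrite -subr_ge0 -[in RHS]subr_ge0; congr (0 <= _); ring.
Qed.

Lemma oracle_selects_soft (a t y : R) : 0 <= a ->
  oracle_selects epsilon Pi1 a s t (soft (a * s) y) =
  (a * s < `|y|) && ((1 - t * (1 - epsilon)) * normal_pdf 0 s y <=
     t * epsilon * mixture_pdf Pi1 s y).
Proof.
move=> a_ge0; have th_ge0 : 0 <= a * s by rewrite mulr_ge0// ltW.
rewrite /oracle_selects; have [yth|thy] := leP `|y| (a * s).
  by rewrite soft_le// eqxx.
rewrite ratio_le soft_gtK// -sgr_eq0 sg_soft// sgr_eq0 -normr_eq0.
by rewrite gt_eqF// (le_lt_trans th_ge0).
Qed.

Lemma measurable_selection (a t : R) : 0 <= a -> measurable
  [set y | oracle_selects epsilon Pi1 a s t (soft (a * s) y)].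
Proof.
move=> a_ge0.
have -> : [set y | oracle_selects epsilon Pi1 a s t (soft (a * s) y)] =
    [set y | a * s < `|y|] `&` [set y |
      (1 - t * (1 - epsilon)) * normal_pdf 0 s y <=
      t * epsilon * mixture_pdf Pi1 s y].
  by apply/seteqP; split => y /=; rewrite oracle_selects_soft// => /andP.
have msetP (b : R -> bool) : measurable_fun setT b -> measurable [set y | b y].
  move=> mb; rewrite -[X in measurable X]setTI.
  exact: (mb measurableT [set true]).
apply: measurableI; apply: msetP.
  by apply: measurable_fun_ltr => //; exact: measurable_normr.
apply: measurable_fun_ler; apply: measurable_funM => //.
  exact: measurable_normal_pdf.
exact: measurable_mixture_pdf.
Qed.

End selection.

(** * Comparison of the null selection probabilities *)

Lemma prob_signal_noise_integral (R : realType) (L : probability R R) (s0 s : R)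
    (A : set R) (psi : R -> \bar R) :
  0 < s0 -> 0 < s -> measurable A -> measurable_fun setT psi ->
  (forall y, (0 <= psi y)%E) ->
  (forall u, (normal_prob u s A =
      \int[lebesgue_measure]_y (psi y * (normal_pdf u s0 y)%:E))%E) ->
  ((prob_signal_noise L s A)%:E =
   \int[lebesgue_measure]_y (psi y * (mixture_pdf L s0 y)%:E))%E.
Proof.
move=> s0_gt0 s_gt0 mA mpsi psi_ge0 psiE.
under eq_integral do rewrite -EFin_mixture_pdf//.
rewrite -(signal_noise_integral _ _ _ _ _ _ s0_gt0 s_gt0 mA)// fineK//.
pose P : subprobability _ R := product_subprobability
  (L : subprobability _ R, normal_prob 0 1 : subprobability _ R).
apply: (fin_num_measure P); rewrite -[X in measurable X]setTI.
have mphi : measurable_fun setT (fun w : R * R => w.1 + s * w.2).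
  by apply: measurable_funD => //; exact: measurable_funM.
exact: (mphi measurableT A mA).
Qed.

Lemma prob_noise_normal_prob (R : realType) (s : R) (A : set R) : 0 < s ->
  measurable A -> ((prob_noise s A)%:E = normal_prob 0 s A)%E.
Proof.
move=> s_gt0 mA; rewrite /prob_noise -(normal_prob_affine _ 0 s A s_gt0 mA).
under [in RHS]eq_set do rewrite add0r.
rewrite fineK//; apply: fin_num_measure; rewrite -[X in measurable X]setTI.
have mphi : measurable_fun setT (fun z : R => s * z) by exact: measurable_funM.
exact: (mphi measurableT A mA).
Qed.

Lemma null_selection_prob_le (R : realType) (epsilon : R)
    (Pi1 : probability R R) (a0 s0 t0 a s t x : R) :
  0 < epsilon -> epsilon < 1 -> 0 <= a0 -> 0 <= a -> 0 < s0 -> s0 <= s ->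
  0 <= t0 -> 0 < x ->
  ~~ (q0 a0 s0 x / q epsilon Pi1 a0 s0 x <= t0) ->
  ~~ (q0 a0 s0 (- x) / q epsilon Pi1 a0 s0 (- x) <= t0) ->
  tpp_formula epsilon Pi1 a0 s0 t0 = tpp_formula epsilon Pi1 a s t ->
  null_selection_prob epsilon Pi1 a0 s0 t0 <=
    null_selection_prob epsilon Pi1 a s t.
Proof.
move=> eps_gt0 eps_lt1 a0_ge0 a_ge0 s0_gt0 s0_le t0_ge0 x_gt0.
have s_gt0 := lt_le_trans s0_gt0 s0_le.
set k := 1 - t0 * (1 - epsilon); set c := t0 * epsilon.
pose y0 := x + a0 * s0.
have ratio_gt z : ~~ (q0 a0 s0 z / q epsilon Pi1 a0 s0 z <= t0) ->
    c * mixture_pdf Pi1 s0 (z + a0 * s0 * Num.sg z) <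
    k * normal_pdf 0 s0 (z + a0 * s0 * Num.sg z).
  by rewrite (ratio_le epsilon Pi1 s0 eps_gt0 eps_lt1 s0_gt0 a0 t0 z) -ltNge.
have y0E : x + a0 * s0 * Num.sg x = y0 by rewrite gtr0_sg// mulr1.
have y0NE : - x + a0 * s0 * Num.sg (- x) = - y0.
  by rewrite sgrN gtr0_sg// mulrN1 -opprD.
move=> /ratio_gt; rewrite y0E => out_r /ratio_gt; rewrite y0NE => out_l.
have c_ge0 : 0 <= c by rewrite mulr_ge0// ltW.
(* At [y0] a non-negative quantity lies strictly below [k] times a positive density. *)
have k_gt0 : 0 < k.
  have := le_lt_trans (mulr_ge0 c_ge0 (mixture_pdf_ge0 Pi1 s0 y0)) out_r.
  by rewrite pmulr_lgt0// normal_pdf_gt0.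
set A0 := [set y | oracle_selects epsilon Pi1 a0 s0 t0 (soft (a0 * s0) y)].
set A := [set y | oracle_selects epsilon Pi1 a s t (soft (a * s) y)].
have mA0 : measurable A0 by exact: measurable_selection.
have mA : measurable A by exact: measurable_selection.
pose chi (y : R) : \bar R := (\1_A0 y)%:E.
have mchi : measurable_fun setT chi.
  by apply/measurable_EFinP; exact: measurable_indic.
have chi_ge0 y : (0 <= chi y)%E by rewrite lee_fin.
have chiE y : chi y = if k * normal_pdf 0 s0 y <= c * mixture_pdf Pi1 s0 y
    then 1%E else 0%E.
  have -> : chi y =
      (oracle_selects epsilon Pi1 a0 s0 t0 (soft (a0 * s0) y))%:R%:E.
    rewrite /chi indicE; congr ((nat_of_bool _)%:R%:E).
    by apply/idP/idP; rewrite inE.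
  (* For [|y| <= a0 * s0] the oracle selects nothing; there [y] lies between [- y0] and [y0], where
     the likelihood-ratio test fails by convexity, so the two tests agree everywhere. *)
  rewrite oracle_selects_soft// -/k -/c.
  have [yth|] := leP `|y| (a0 * s0); last by case: ifP.
  rewrite leNgt (mixture_pdf_lt_itv _ _ s0_gt0 _ _ (- y0) _ y0)//.
  by rewrite -ler_norml (le_trans yth)// lerDr ltW.
(* The competitor of [chi]: the oracle at level [s], simulated at level [s0] with the same null and
   signal selection probabilities. *)
have [psi [mpsi psi01 psiE]] := normal_prob_randomized _ _ _ _ s0_gt0 s0_le mA.
have psi_ge0 y : (0 <= psi y)%E by case/andP: (psi01 y).
have chi_int u : (normal_prob u s0 A0 =
    \int[lebesgue_measure]_y (chi y * (normal_pdf u s0 y)%:E))%E.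
  exact: normal_prob_indic.
have tE0 := prob_signal_noise_integral _ Pi1 _ _ _ _ s0_gt0 s0_gt0 mA0 mchi
  chi_ge0 chi_int.
have tE := prob_signal_noise_integral _ Pi1 _ _ _ _ s0_gt0 s_gt0 mA mpsi
  psi_ge0 psiE.
rewrite /tpp_formula -/A0 -/A => tpp_eq.
rewrite /null_selection_prob -/A0 -/A -lee_fin.
clearbody chi A A0.
rewrite (prob_noise_normal_prob _ _ _ s0_gt0 mA0).
rewrite (prob_noise_normal_prob _ _ _ s_gt0 mA) chi_int psiE.
apply: (neyman_pearson R (normal_pdf 0 s0) (mixture_pdf Pi1 s0) chi psi k c
  (measurable_normal_pdf 0 s0) (measurable_mixture_pdf Pi1 s0 s0_gt0)
  (normal_pdf_ge0 0 s0) (mixture_pdf_ge0 Pi1 s0) mchi mpsi psi01 k_gt0 c_ge0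
  chiE).
  by rewrite -tE.
by rewrite -tE -tE0 tpp_eq.
Qed.

(** * Consequences of the hypotheses and conclusion *)

Lemma state_evolution_tau_le (R : realType) (delta sigma : R)
    (Pi : probability R R) (l a s l' a' s' : R) : 0 < delta ->
  state_evolution delta sigma Pi l a s ->
  state_evolution delta sigma Pi l' a' s' ->
  (asymptotic_mse Pi a s <= asymptotic_mse Pi a' s')%E -> s <= s'.
Proof.
move=> delta_gt0 [_ s_gt0 sE _] [_ s'_gt0 s'E _] mse_le.
rewrite -(@ler_pXn2r _ 2)// ?nnegrE ?(ltW s_gt0) ?(ltW s'_gt0)//.
rewrite -lee_fin sE s'E leeD2l//.
by rewrite lee_wpmul2l// lee_fin invr_ge0 ltW.
Qed.

(** All selected intervals stay beyond [Delta] in absolute value, and [f0 / f] agrees with [q0 / q]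
    off 0, so every nonzero point of the gap, such as [Delta / 2], is rejected. *)
Lemma interval_condition_out (R : realType) (epsilon : R)
    (Pi1 Pi : probability R R) (a s t0 t : R) :
  interval_condition epsilon Pi1 Pi a s t0 -> 0 < t -> t <= t0 ->
  exists2 x : R, 0 < x &
    ~~ (q0 a s x / q epsilon Pi1 a s x <= t) /\
    ~~ (q0 a s (- x) / q epsilon Pi1 a s (- x) <= t).
Proof.
move=> [_ [Delta Delta_gt0 H]] t_gt0 t_le.
have [n [I [lo [hi [setE _ Ilohi _ away]]]]] := H t t_gt0 t_le.
have out x : x != 0 -> `|x| < Delta -> ~~ (q0 a s x / q epsilon Pi1 a s x <= t).
  move=> x_neq0 xD; apply/negP => xt.
  have : [set x | f0 a s x / f epsilon Pi1 Pi a s x <= t] x.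
    by rewrite /= /f0 /f (negbTE x_neq0).
  rewrite setE => -[m _ Imx].
  move: xD; rewrite ltr_norml => /andP[x_gt x_lt].
  have [_ /(_ _ Imx) [lo_le hi_ge]] := Ilohi m.
  have [lo_gt|hi_lt] := away m.
    by have := lt_le_trans lo_gt lo_le; rewrite lte_fin ltNge ltW.
  by have := le_lt_trans hi_ge hi_lt; rewrite lte_fin ltNge ltW.
have x_gt0 : 0 < Delta / 2 by rewrite divr_gt0.
have xD : `|Delta / 2| < Delta.
  by rewrite gtr0_norm// ltr_pdivrMr// ltr_pMr// ltr1n.
exists (Delta / 2) => //.
by split; apply: out; rewrite ?oppr_eq0 ?normrN ?gt_eqF.
Qed.

Lemma ler_divD (R : realFieldType) (N N' c : R) :
  0 <= N -> N <= N' -> 0 <= c -> N / (N + c) <= N' / (N' + c).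
Proof.
move=> N_ge0 NN' c_ge0; have N'_ge0 := le_trans N_ge0 NN'.
(* The denominator [N + c] can vanish only here, where the quotient is 0 by convention. *)
have [->|N_neq0] := eqVneq N 0; first by rewrite mul0r divr_ge0 ?addr_ge0.
have N_gt0 : 0 < N by rewrite lt_neqAle eq_sym N_neq0.
have N'_gt0 : 0 < N' by exact: lt_le_trans NN'.
rewrite ler_pdivrMr ?ltr_wpDr// mulrAC ler_pdivlMr ?ltr_wpDr//.
by rewrite !mulrDr (mulrC N') lerD2l ler_wpM2r.
Qed.

Lemma fdp_formula_le (R : realType) (epsilon : R) (Pi1 : probability R R)
    (a s t a' s' t' : R) : 0 <= epsilon -> epsilon <= 1 ->
  tpp_formula epsilon Pi1 a s t = tpp_formula epsilon Pi1 a' s' t' ->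
  null_selection_prob epsilon Pi1 a s t <=
    null_selection_prob epsilon Pi1 a' s' t' ->
  fdp_formula epsilon Pi1 a s t <= fdp_formula epsilon Pi1 a' s' t'.
Proof.
move=> eps_ge0 eps_le1 tppE null_le; rewrite /fdp_formula tppE.
have null_ge0 : 0 <= null_selection_prob epsilon Pi1 a s t by rewrite fine_ge0.
have tpp_ge0 : 0 <= tpp_formula epsilon Pi1 a' s' t' by rewrite fine_ge0.
have e1 : 0 <= 1 - epsilon by rewrite subr_ge0.
exact: (ler_divD _ _ _ _ (mulr_ge0 e1 null_ge0) (ler_wpM2l e1 null_le)
  (mulr_ge0 eps_ge0 tpp_ge0)).
Qed.

Theorem theorem4p10 (R : realType) (delta sigma epsilon : R)
  (Pi Pi1 : probability R R)
  (delta_gt0 : 0 < delta) (sigma_gt0 : 0 < sigma)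
  (epsilon_gt0 : 0 < epsilon) (epsilon_lt1 : epsilon < 1)
  (Pi1_neq0 : Pi1 [set (0 : R)] = 0%E)
  (Pi_mixture : is_mixture epsilon Pi1 Pi)
  (Pi_moment2 : (\int[Pi]_x (x ^+ 2)%:E < +oo)%E)
  (M : linear_model delta sigma Pi)
  (bhat : R -> forall p, sample_space M p -> 'cV[R]_p)
  (bhat_lasso : is_lasso bhat)
  (alpha tau : R -> R)
  (alpha_tau_solution : forall l : R, 0 < l ->
     unique (fun u => state_evolution delta sigma Pi l u.1 u.2)
            (alpha l, tau l))
  (lambda_star lambda : R)
  (lambda_star_gt0 : 0 < lambda_star)
  (lambda_star_min : forall l : R, 0 < l ->
     (asymptotic_mse Pi (alpha lambda_star) (tau lambda_star) <=
      asymptotic_mse Pi (alpha l) (tau l))%E)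
  (lambda_gt0 : 0 < lambda) (lambda_neq : lambda <> lambda_star)
  (t0_star : R)
  (interval_star : interval_condition epsilon Pi1 Pi
     (alpha lambda_star) (tau lambda_star) t0_star)
  (interval_lambda : exists t0 : R, interval_condition epsilon Pi1 Pi
     (alpha lambda) (tau lambda) t0)
  (t_star t : R) (t_star_gt0 : 0 < t_star) (t_star_le : t_star <= t0_star)
  (* the limits in probability are given by the asymptotic formulas *)
  (formulas_star : oracle_limits bhat epsilon Pi1 alpha tau t_star lambda_star
     (tpp_formula epsilon Pi1 (alpha lambda_star) (tau lambda_star) t_star)
     (fdp_formula epsilon Pi1 (alpha lambda_star) (tau lambda_star) t_star))
  (formulas_lambda : oracle_limits bhat epsilon Pi1 alpha tau t lambda
     (tpp_formula epsilon Pi1 (alpha lambda) (tau lambda) t)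
     (fdp_formula epsilon Pi1 (alpha lambda) (tau lambda) t))
  (xi fdp_star fdp : R)
  (limits_star :
     oracle_limits bhat epsilon Pi1 alpha tau t_star lambda_star xi fdp_star)
  (limits_lambda :
     oracle_limits bhat epsilon Pi1 alpha tau t lambda xi fdp) :
  fdp_star <= fdp.
Proof.
(* Uniqueness of limits in probability replaces the given limits by the formulas, so both oracles
   have the same [tpp_formula]. *)
have [xiE_star xiE] :
    xi = tpp_formula epsilon Pi1 (alpha lambda_star) (tau lambda_star) t_star /\
    xi = tpp_formula epsilon Pi1 (alpha lambda) (tau lambda) t.
  by split; [exact: cvg_in_prob_unique limits_star.1 formulas_star.1|
             exact: cvg_in_prob_unique limits_lambda.1 formulas_lambda.1].
rewrite (cvg_in_prob_unique _ _ _ _ _ _ _ _ limits_star.2 formulas_star.2).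
rewrite (cvg_in_prob_unique _ _ _ _ _ _ _ _ limits_lambda.2 formulas_lambda.2).
have [/= se_star _] := alpha_tau_solution _ lambda_star_gt0.
have [/= se _] := alpha_tau_solution _ lambda_gt0.
have tau_le := state_evolution_tau_le _ _ _ _ _ _ _ _ _ _ delta_gt0 se_star se
  (lambda_star_min _ lambda_gt0).
have [/ltW alpha_star_ge tau_star_gt0 _ _] := se_star.
have [/ltW alpha_ge _ _ _] := se.
have [x x_gt0 [out_r out_l]] := interval_condition_out _ _ _ _ _ _ _ _
  interval_star t_star_gt0 t_star_le.
have tppE := etrans (esym xiE_star) xiE.
apply: (fdp_formula_le _ _ _ _ _ _ _ _ _
  (ltW epsilon_gt0) (ltW epsilon_lt1) tppE).
exact: (null_selection_prob_le _ _ _ _ _ _ _ _ _ x epsilon_gt0 epsilon_lt1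
  (le_trans (alpha_min_ge0 _ _) alpha_star_ge)
  (le_trans (alpha_min_ge0 _ _) alpha_ge)
  tau_star_gt0 tau_le (ltW t_star_gt0) x_gt0 out_r out_l tppE).
Qed.
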